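(* Let $V=H_3(\mathbb{O})$ and $W=\mathcal{F}_2\oplus\mathcal{F}_3\subset V$. Define $j:W\to\mathbb{P}(V)$ by $$j(x)=\bigl[e_1+x-e_1\times x^{\#}\bigr]\qquad(x\in W).$$ Then $j$ is a biholomorphism of $W$ onto an open dense subset of the manifold $\mathcal{P}=\{[z]\in\mathbb{P}(V): z^{\#}=0\}$.
   Context: $\mathbb{O}_c$ is the real 8-dimensional division algebra of octonions with positive definite multiplicative norm $n$, Cayley conjugation $a\mapsto\widetilde a$ ($a\widetilde a=n(a)1$), and bilinear form $(a:b)=n(a+b)-n(a)-n(b)$. $\mathbb{O}=\mathbb{C}\otimes_{\mathbb{R}}\mathbb{O}_c$ is the complex octonion algebra, with product, $n$, $\widetilde{\ }$ and $(\,:\,)$ extended complex (multi)linearly/quadratically. $H_3(\mathbb{O})$ is the 27-dimensional complex vector space of matrices $a=\begin{pmatrix}\alpha_1&a_3&\widetilde{a_2}\\ \widetilde{a_3}&\alpha_2&a_1\\ a_2&\widetilde{a_1}&\alpha_3\end{pmatrix}$, $\alpha_i\in\mathbb{C}$, $a_i\in\mathbb{O}$, written $a=\sum\alpha_ie_i+\sum F_i(a_i)$; $\mathcal{F}_i=\{F_i(a):a\in\mathbb{O}\}$. Put $a^{\#}=\sum_i(\alpha_j\alpha_k-n(a_i))e_i+\sum_iF_i\bigl((a_ja_k)^{\sim}-\alpha_ia_i\bigr)$, where $(i,j,k)$ is the even (cyclic) permutation of $(1,2,3)$ starting with $i$, and $a\times b=(a+b)^{\#}-a^{\#}-b^{\#}$.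 $\mathbb{P}(V)$ is the complex projective space of lines in $V$ and $[z]$ is the class of $z\ne0$. *)

(* Defs.v *)
From HB Require Import structures.
From mathcomp Require Import all_boot all_order all_algebra.
From mathcomp Require Import ring.
From mathcomp Require Import all_classical all_reals all_analysis.
From mathcomp Require Export complex.
Set Implicit Arguments.
Unset Strict Implicit.
Unset Printing Implicit Defensive.
Import Order.TTheory GRing.Theory Num.Theory.
Import numFieldNormedType.Exports.
Local Open Scope classical_set_scope.
Local Open Scope ring_scope.

Section Octonions.
Variable K : comNzRingType.

(* Cayley-Dickson doubling (a, b)(c, d) = (a c - d~ b, d a + b c~) and
   (a, b)~ = (a~, - b), for an algebra carried by 'rV_m. *)
Definition cd_mul m (mul : 'rV[K]_m -> 'rV[K]_m -> 'rV[K]_m)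
    (conj : 'rV[K]_m -> 'rV[K]_m) (x y : 'rV[K]_(m + m)) : 'rV[K]_(m + m) :=
  let a := lsubmx x in let b := rsubmx x in
  let c := lsubmx y in let d := rsubmx y in
  row_mx (mul a c - mul (conj d) b) (mul d a + mul b (conj c)).

Definition cd_conj m (conj : 'rV[K]_m -> 'rV[K]_m) (x : 'rV[K]_(m + m)) :
    'rV[K]_(m + m) :=
  row_mx (conj (lsubmx x)) (- rsubmx x).

Definition mul1 (x y : 'rV[K]_1) : 'rV[K]_1 := x *m y.
Definition conj1 (x : 'rV[K]_1) : 'rV[K]_1 := x.
Definition mul2 := cd_mul mul1 conj1.
Definition conj2 := cd_conj conj1.
Definition mul4 := cd_mul mul2 conj2.
Definition conj4 := cd_conj conj2.

(* Octonions over K in the standard basis.  The compact octonions O_c are the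
   case K = R; since the structure constants are integers, their
   complexification is the case K = R[i] (see [omul_map] below). *)
Definition oct := 'rV[K]_8.
Definition omul (x y : oct) : oct := cd_mul mul4 conj4 x y.
Definition oconj (x : oct) : oct := cd_conj conj4 x.
Definition onorm (x : oct) : K := \sum_(i < 8) x 0 i ^+ 2.
Definition oone : oct := delta_mx 0 0.

Let v2 (a b : K) : 'rV[K]_(1 + 1) := row_mx a%:M b%:M.
Let v4 a b c d : 'rV[K]_(1 + 1 + (1 + 1)) := row_mx (v2 a b) (v2 c d).
Let v8 a b c d e f g h : 'rV[K]_(1 + 1 + (1 + 1) + (1 + 1 + (1 + 1))) :=
  row_mx (v4 a b c d) (v4 e f g h).

Let v2D a b a' b' : v2 a b + v2 a' b' = v2 (a + a') (b + b').
Proof. by rewrite /v2 add_row_mx -!raddfD. Qed.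
Let v2N a b : - v2 a b = v2 (- a) (- b).
Proof. by rewrite /v2 opp_row_mx -!raddfN. Qed.
Let v4D a b c d a' b' c' d' :
  v4 a b c d + v4 a' b' c' d' = v4 (a + a') (b + b') (c + c') (d + d').
Proof. by rewrite /v4 add_row_mx !v2D. Qed.
Let v4N a b c d : - v4 a b c d = v4 (- a) (- b) (- c) (- d).
Proof. by rewrite /v4 opp_row_mx !v2N. Qed.

Let v4Z k a b c d : k *: v4 a b c d = v4 (k * a) (k * b) (k * c) (k * d).
Proof. by rewrite /v4 /v2 !scale_row_mx !scale_scalar_mx. Qed.

Let mul2E a b c d :
  mul2 (v2 a b) (v2 c d) = v2 (a * c - d * b) (d * a + b * c).
Proof.
rewrite /mul2 /cd_mul /mul1 /conj1 !row_mxKl !row_mxKr -!scalar_mxM.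
by rewrite -raddfB -raddfD.
Qed.
Let conj2E a b : conj2 (v2 a b) = v2 a (- b).
Proof. by rewrite /conj2 /cd_conj /conj1 row_mxKl row_mxKr -raddfN. Qed.

Let mul4E a b c d a' b' c' d' : mul4 (v4 a b c d) (v4 a' b' c' d') =
  v4 (a * a' - b' * b - (c' * c + d * d')) (b' * a + b * a' - (d * c' - d' * c))
     (c' * a - b * d' + (c * a' + b' * d)) (b * c' + d' * a + (d * a' - b' * c)).
Proof.
rewrite /mul4 /cd_mul !row_mxKl !row_mxKr !conj2E !mul2E !v2N !v2D.
by congr v4; ring.
Qed.
Let conj4E a b c d : conj4 (v4 a b c d) = v4 a (- b) (- c) (- d).
Proof. by rewrite /conj4 /cd_conj row_mxKl row_mxKr conj2E v2N. Qed.

Let v8P (x : oct) : exists a b c d e f g h, x = v8 a b c d e f g h.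
Proof.
pose y : 'rV[K]_(1 + 1 + (1 + 1) + (1 + 1 + (1 + 1))) := x.
pose s (z : 'rV[K]_1) := z 0 0.
have sE z : (s z)%:M = z by apply/matrixP => i j; rewrite !ord1 mxE eqxx.
exists (s (lsubmx (lsubmx (lsubmx y)))), (s (rsubmx (lsubmx (lsubmx y)))).
exists (s (lsubmx (rsubmx (lsubmx y)))), (s (rsubmx (rsubmx (lsubmx y)))).
exists (s (lsubmx (lsubmx (rsubmx y)))), (s (rsubmx (lsubmx (rsubmx y)))).
exists (s (lsubmx (rsubmx (rsubmx y)))), (s (rsubmx (rsubmx (rsubmx y)))).
by rewrite /v8 /v4 /v2 !sE !hsubmxK.
Qed.

Let onormE a b c d e f g h : onorm (v8 a b c d e f g h) =
  a ^+ 2 + b ^+ 2 + (c ^+ 2 + d ^+ 2) + (e ^+ 2 + f ^+ 2 + (g ^+ 2 + h ^+ 2)).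
Proof.
rewrite /onorm.
have E (m n : nat) (u : 'rV[K]_m) (v : 'rV[K]_n) :
    \sum_(i < m + n) row_mx u v 0 i ^+ 2 =
    \sum_(i < m) u 0 i ^+ 2 + \sum_(i < n) v 0 i ^+ 2.
  by rewrite big_split_ord /=; congr (_ + _); apply: eq_bigr => i _;
    rewrite (row_mxEl, row_mxEr).
have E1 k : \sum_(i < 1) (k%:M : 'rV[K]_1) 0 i ^+ 2 = k ^+ 2.
  by rewrite big_ord1 mxE eqxx mulr1n.
rewrite -[LHS]/(\sum_(i < 1 + 1 + (1 + 1) + (1 + 1 + (1 + 1)))
  row_mx (v4 a b c d) (v4 e f g h) 0 i ^+ 2).
by rewrite !E !E1.
Qed.

Lemma onorm_mul (x y : oct) : onorm (omul x y) = onorm x * onorm y.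
Proof.
have [a [b [c [d [e [f [g [h ->]]]]]]]] := v8P x.
have [a' [b' [c' [d' [e' [f' [g' [h' ->]]]]]]]] := v8P y.
rewrite /omul /cd_mul !row_mxKl !row_mxKr !conj4E !mul4E v4N !v4D.
rewrite -/(v8 _ _ _ _ _ _ _ _) !onormE; ring.
Qed.

Lemma omul_conj (x : oct) : omul x (oconj x) = onorm x *: oone.
Proof.
have [a [b [c [d [e [f [g [h ->]]]]]]]] := v8P x.
rewrite onormE /omul /oconj /cd_mul /cd_conj !row_mxKl !row_mxKr !conj4E !v4N.
rewrite !mul4E !conj4E !mul4E v4N !v4D.
have -> : oone = v8 1 0 0 0 0 0 0 0.
  have E n : (delta_mx 0 0 : 'rV[K]_(n.+1 + n.+1)) = row_mx (delta_mx 0 0) 0.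
    rewrite -[LHS](@hsubmxK _ _ n.+1 n.+1); congr row_mx; apply/matrixP => i j;
    by rewrite !mxE //= -!val_eqE /= ?andbF.
  rewrite /oone (E 3) (E 1%N) (E 0%N) /v8 /v4 /v2 !raddf0 !row_mx0.
  suff -> : delta_mx 0 0 = 1%:M :> 'rV[K]_1 by [].
  by apply/matrixP => i j; rewrite !mxE !ord1.
apply: esym; apply: etrans (@scale_row_mx K 1 4 4 _ (v4 _ _ _ _) (v4 _ _ _ _)) _; apply: esym.
rewrite !v4Z.
by congr (row_mx (v4 _ _ _ _) (v4 _ _ _ _)); ring.
Qed.

End Octonions.

Lemma omul_map (K L : comNzRingType) (f : {rmorphism K -> L}) (x y : oct K) :
  omul (map_mx f x) (map_mx f y) = map_mx f (omul x y).
Proof.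
have cm m mulK mulL conjK conjL :
    (forall x y : 'rV[K]_m,
      mulL (map_mx f x) (map_mx f y) = map_mx f (mulK x y)) ->
    (forall x : 'rV[K]_m, conjL (map_mx f x) = map_mx f (conjK x)) ->
    forall x y, cd_mul mulL conjL (map_mx f x) (map_mx f y) =
                map_mx f (cd_mul mulK conjK x y).
  move=> hm hc u v; rewrite /cd_mul map_row_mx map_mxB map_mxD.
  by rewrite -!map_lsubmx -!map_rsubmx !hc !hm.
have cc m conjK conjL :
    (forall x : 'rV[K]_m, conjL (map_mx f x) = map_mx f (conjK x)) ->
    forall x, cd_conj conjL (map_mx f x) = map_mx f (cd_conj conjK x).
  move=> hc u; rewrite /cd_conj map_row_mx map_mxN.
  by rewrite -!map_lsubmx -!map_rsubmx hc.
have m1 (u v : 'rV[K]_1) : mul1 (map_mx f u) (map_mx f v) = map_mx f (mul1 u v).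
  by rewrite /mul1 map_mxM.
have c1 (u : 'rV[K]_1) : conj1 (map_mx f u) = map_mx f (conj1 u) by [].
have c2 := cc _ _ _ c1.
exact: cm _ _ _ _ _ (cm _ _ _ _ _ (cm _ _ _ _ _ m1 c1) c2) (cc _ _ _ c2) x y.
Qed.

Section H3.
Variable K : comNzRingType.

(* The matrix with diagonal (alpha_1, alpha_2, alpha_3) and octonion entries
   a_1, a_2, a_3 at the places (2,3), (3,1), (1,2), the entries at the
   transposed places being their conjugates, is stored by its coordinates.
   The index set {1, 2, 3} is shifted to 'I_3 = {0, 1, 2}, whose addition is
   modulo 3, so that (i, i + 1, i + 2) are the cyclic permutations. *)
Definition H3 := 'rV[K]_27.

Definition h3 (alpha : 'I_3 -> K) (a : 'I_3 -> oct K) : H3 :=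
  row_mx (\row_i alpha i) (mxvec (\matrix_i a i)).
Definition h3diag (z : H3) (i : 'I_3) : K :=
  lsubmx (z : 'rV[K]_(3 + 3 * 8)) 0 i.
Definition h3oct (z : H3) (i : 'I_3) : oct K :=
  row i (vec_mx (rsubmx (z : 'rV[K]_(3 + 3 * 8)))).

Definition h3e (i : 'I_3) : H3 := h3 (fun k => (k == i)%:R) (fun=> 0).
Definition h3F (i : 'I_3) (a : oct K) : H3 :=
  h3 (fun=> 0) (fun k => if k == i then a else 0).

Definition sharp (z : H3) : H3 :=
  h3 (fun i => h3diag z (i + 1) * h3diag z (i + 2) - onorm (h3oct z i))
     (fun i => oconj (omul (h3oct z (i + 1)) (h3oct z (i + 2)))
               - h3diag z i *: h3oct z i).

Definition cross (a b : H3) : H3 := sharp (a + b) - sharp a - sharp b.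

Definition calF (i : 'I_3) : set H3 := range (h3F i).

Lemma h3_diag alpha a i : h3diag (h3 alpha a) i = alpha i.
Proof. by rewrite /h3diag row_mxKl mxE. Qed.

Lemma h3_oct alpha a i : h3oct (h3 alpha a) i = a i.
Proof. by rewrite /h3oct row_mxKr mxvecK rowK. Qed.

Lemma h3K z : h3 (h3diag z) (h3oct z) = z.
Proof.
pose y : 'rV[K]_(3 + 3 * 8) := z.
rewrite /h3; have -> : \row_i h3diag z i = lsubmx y.
  by apply/rowP => i; rewrite mxE.
have -> : \matrix_i h3oct z i = vec_mx (rsubmx y).
  by apply/row_matrixP => i; rewrite rowK.
by rewrite vec_mxK hsubmxK.
Qed.

Lemma h3diagB z w i : h3diag (z - w) i = h3diag z i - h3diag w i.
Proof. by rewrite /h3diag !mxE. Qed.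

Lemma h3diagD z w i : h3diag (z + w) i = h3diag z i + h3diag w i.
Proof. by rewrite /h3diag !mxE. Qed.

Lemma h3octD z w i : h3oct (z + w) i = h3oct z i + h3oct w i.
Proof. by apply/rowP => k; rewrite !mxE. Qed.

End H3.

(* For K = R[i], a space with a holomorphic atlas of dimension n: a map between
   open sets of 'rV[K]_m and 'rV[K]_n is holomorphic when it is
   K-differentiable at every point.  cm_param i is a left inverse of cm_chart i
   on cm_dom i, with arbitrary values off the image of the chart.  Separation
   and countability axioms play no role in the notions below and are not
   required. *)
Record cmanifold (K : numFieldType) (n : nat) := CManifold {
  cm_space :> topologicalType;
  cm_index : Type;
  cm_dom : cm_index -> set cm_space;
  cm_chart : cm_index -> cm_space -> 'rV[K]_n;
  cm_param : cm_index -> 'rV[K]_n -> cm_space;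
  cm_cover : forall x, exists i, cm_dom i x;
  cm_dom_open : forall i, open (cm_dom i);
  cm_img_open : forall i, open (cm_chart i @` cm_dom i);
  cm_chartK : forall i x, cm_dom i x -> cm_param i (cm_chart i x) = x;
  cm_chart_cont : forall i x, cm_dom i x -> {for x, continuous (cm_chart i)};
  cm_param_cont : forall i x, cm_dom i x ->
    {for cm_chart i x, continuous (cm_param i)};
  cm_transition : forall i j x, cm_dom i x -> cm_dom j x ->
    differentiable (cm_chart j \o cm_param i) (cm_chart i x)
}.

Section Holomorphic.
Variables (K : numFieldType) (m n : nat).
Variables (M : cmanifold K m) (N : cmanifold K n).

Definition holomorphic (U : set M) (f : M -> N) : Prop :=
  open U /\ forall x, U x ->
    {for x, continuous f} /\
    forall i j, cm_dom i x -> cm_dom j (f x) ->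
      differentiable (cm_chart j \o f \o cm_param i) (cm_chart i x).

(* Holomorphy on an arbitrary subset A: local extendability to a holomorphic
   map on an open set of M.  When A is an open subset of an embedded complex
   submanifold, this is holomorphy for the induced complex structure.
   The values of f outside A are irrelevant. *)
Definition holomorphic_on (A : set M) (f : M -> N) : Prop :=
  forall x, A x -> exists U g,
    [/\ U x, holomorphic U g & forall y, A y -> U y -> f y = g y].

End Holomorphic.

Definition biholomorphism (K : numFieldType) (m n : nat)
    (M : cmanifold K m) (N : cmanifold K n)
    (A : set M) (B : set N) (f : M -> N) : Prop :=
  [/\ set_bij A B f, holomorphic_on A f &
      exists g : N -> M, holomorphic_on B g /\ forall x, A x -> g (f x) = x].

Definition open_in (T : topologicalType) (P O : set T) : Prop :=
  exists2 U, open U & O = P `&` U.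

Definition dense_in (T : topologicalType) (P O : set T) : Prop :=
  O `<=` P /\ P `<=` closure O.

Section AffineSpace.
Variables (K : numFieldType) (n : nat).

Let V : topologicalType := 'rV[K]_n.

Fact affine_img_open (i : unit) : open (@id V @` setT).
Proof. by rewrite image_id; exact: openT. Qed.

Fact affine_transition (i j : unit) (x : 'rV[K]_n) : setT x -> setT x ->
  differentiable ((id : 'rV[K]_n -> 'rV[K]_n) \o id) x.
Proof. by move=> _ _; exact: ex_diff. Qed.

Definition affine_space : cmanifold K n :=
  @CManifold K n V unit (fun=> setT) (fun=> id) (fun=> id)
    (fun=> ex_intro _ tt I) (fun=> openT) affine_img_open (fun _ _ _ => erefl)
    (fun _ _ _ => cvg_id) (fun _ _ _ => cvg_id) affine_transition.

End AffineSpace.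

Section Projective.
Variables (K : numFieldType) (n : nat).

Record projspace := ProjSpace {
  pline :> {vspace 'rV[K]_n.+1};
  _ : \dim pline == 1%N }.

HB.instance Definition _ := [isSub for pline].
HB.instance Definition _ := [Choice of projspace by <:].

Fact dim_delta0 : \dim <[delta_mx ord0 ord0 : 'rV[K]_n.+1]>%VS == 1%N.
Proof.
rewrite dim_vline; have -> // : (delta_mx ord0 ord0 : 'rV[K]_n.+1) != 0.
by apply/eqP => /matrixP/(_ 0 0)/eqP; rewrite !mxE oner_eq0.
Qed.

(* The line spanned by z, for z != 0; the value at 0 is a dummy. *)
Definition pclass (z : 'rV[K]_n.+1) : projspace :=
  insubd (ProjSpace dim_delta0) <[z]>%VS.

Lemma pclassE z : z != 0 -> pclass z = <[z]>%VS :> {vspace _}.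
Proof. by move=> z0; rewrite /pclass insubdK // unfold_in dim_vline z0. Qed.

(* A nonzero vector on the line L. *)
Definition prep (L : projspace) : 'rV[K]_n.+1 := vpick L.

Lemma pline_neq0 (L : projspace) : prep L != 0.
Proof. by rewrite /prep; case: L => L /= dL; rewrite vpick0 -dimv_eq0 (eqP dL). Qed.

Lemma pline_inj : injective pline.
Proof. exact: val_inj. Qed.

Lemma vpickK (L : projspace) : pclass (prep L) = L.
Proof.
apply: pline_inj; rewrite pclassE ?pline_neq0 //.
apply/eqP; rewrite eqEdim; rewrite -memvE memv_pick dim_vline pline_neq0.
by case: L => L /= /eqP ->.
Qed.

Lemma vpick_class z : z != 0 -> exists2 c, c != 0 & prep (pclass z) = c *: z.
Proof.
move=> z0; have : prep (pclass z) \in <[z]>%VS by rewrite -pclassE ?memv_pick.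
move=> /vlineP[c E].
exists c => //.
by apply: contraNneq (pline_neq0 (pclass z)) => c0; rewrite E c0 scale0r.
Qed.

Lemma pclassZ c z : c != 0 -> z != 0 -> pclass (c *: z) = pclass z.
Proof.
move=> c0 z0; apply: pline_inj; rewrite !pclassE ?scaler_eq0 ?negb_or ?c0 //.
apply/eqP; rewrite eqEdim -memvE memvZ ?memv_line //= !dim_vline.
by rewrite scaler_eq0 negb_or c0 z0.
Qed.

(* Quotient topology of 'rV[K]_n.+1 minus 0. *)
Definition proj_open (A : set projspace) : Prop :=
  open [set z : 'rV[K]_n.+1 | z != 0 /\ A (pclass z)].

Lemma open_rV_neq0 : open [set z : 'rV[K]_n.+1 | z != 0].
Proof.
rewrite (_ : [set _ | _] = ~` [set 0]); last first.
  by apply/seteqP; split => z /= /eqP.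
exact/closed_openC/accessible_closed_set1/hausdorff_accessible/norm_hausdorff.
Qed.

Lemma proj_openT : proj_open setT.
Proof.
rewrite /proj_open (_ : [set _ | _] = [set z | z != 0]).
  exact: open_rV_neq0.
by apply/seteqP; split => z //= -[].
Qed.

Lemma proj_openI : setI_closed proj_open.
Proof.
move=> A B oA oB; have := openI oA oB; rewrite /proj_open.
by congr open; apply/seteqP; split => z /=; tauto.
Qed.

Lemma proj_open_bigU (I : Type) (f : I -> set projspace) :
  (forall i, proj_open (f i)) -> proj_open (\bigcup_i f i).
Proof.
move=> of_; have := @bigcup_open _ _ setT _ (fun i _ => of_ i).
rewrite /proj_open; congr open; apply/seteqP; split => z /=.
  by move=> [i _ [z0 fz]]; split=> //; exists i.
by move=> [z0 [i _ fz]]; exists i.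
Qed.

HB.instance Definition _ :=
  isOpenTopological.Build projspace proj_openT proj_openI proj_open_bigU.

Lemma proj_openE (A : set projspace) : open A = proj_open A.
Proof. by []. Qed.

(* Affine charts [z] |-> z / z_i, with the i-th coordinate deleted. *)
Definition proj_dom (i : 'I_n.+1) : set projspace :=
  [set L | prep L 0 i != 0].
Definition proj_chart (i : 'I_n.+1) (L : projspace) : 'rV[K]_n :=
  col' i ((prep L 0 i)^-1 *: prep L).
Definition proj_hom (i : 'I_n.+1) (w : 'rV[K]_n) : 'rV[K]_n.+1 :=
  \row_k oapp (w 0) 1 (unlift i k).
Definition proj_param (i : 'I_n.+1) (w : 'rV[K]_n) : projspace :=
  pclass (proj_hom i w).

Lemma proj_hom_i i w : proj_hom i w 0 i = 1.
Proof. by rewrite mxE unlift_none. Qed.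

Lemma proj_hom_neq0 i w : proj_hom i w != 0.
Proof.
by apply/eqP => /matrixP/(_ 0 i)/eqP; rewrite proj_hom_i mxE oner_eq0.
Qed.

Lemma proj_dom_class i z : z != 0 -> proj_dom i (pclass z) = (z 0 i != 0) :> Prop.
Proof.
move=> z0; have [c c0 E] := vpick_class z0.
by rewrite /proj_dom /= E mxE mulf_eq0 (negPf c0).
Qed.

Lemma proj_chart_class i z : z != 0 ->
  proj_chart i (pclass z) = col' i ((z 0 i)^-1 *: z).
Proof.
move=> z0; have [c c0 E] := vpick_class z0.
rewrite /proj_chart E mxE scalerA invfM.
by rewrite mulrAC mulVf // mul1r.
Qed.

Lemma proj_homK i w : col' i (proj_hom i w) = w.
Proof. by apply/rowP => k; rewrite !mxE liftK. Qed.

Lemma proj_hom_col i (z : 'rV[K]_n.+1) : z 0 i = 1 -> proj_hom i (col' i z) = z.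
Proof.
move=> zi; apply/rowP => k; rewrite mxE.
by case: unliftP => [j ->|->] //=; rewrite mxE.
Qed.

Lemma proj_paramK i w : proj_chart i (proj_param i w) = w.
Proof.
by rewrite proj_chart_class ?proj_hom_neq0 // proj_hom_i invr1 scale1r proj_homK.
Qed.

Lemma proj_chartK i L : proj_dom i L -> proj_param i (proj_chart i L) = L.
Proof.
move=> Li; rewrite /proj_param /proj_chart proj_hom_col ?mxE ?mulVf //.
by rewrite pclassZ ?vpickK ?invr_neq0 ?pline_neq0.
Qed.

Lemma differentiable_rV m (V : normedModType K) (f : V -> 'rV[K]_m) x :
  (forall k, differentiable (fun y => f y 0 k : K) x) -> differentiable f x.
Proof.
move=> df.
rewrite (_ : f = \sum_(k < m) (fun y => f y 0 k *: (delta_mx 0 k : 'rV[K]_m))).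
  by apply: differentiable_sum => k; exact: differentiableZl.
by apply/funext => y; rewrite fct_sumE -row_sum_delta.
Qed.

Lemma differentiable_proj_hom i w : differentiable (proj_hom i) w.
Proof.
apply: differentiable_rV => k.
rewrite (_ : (fun y => _) =
    fun y : 'rV[K]_n => oapp (y 0) 1 (unlift i k)); last first.
  by apply/funext => y; rewrite mxE.
case: (unlift i k) => [j|] /=; first exact: differentiable_coord.
exact: differentiable_cst.
Qed.

Lemma differentiable_chart_class i (z : 'rV[K]_n.+1) : z 0 i != 0 ->
  differentiable (fun z : 'rV[K]_n.+1 => col' i ((z 0 i)^-1 *: z)) z.
Proof.
move=> zi; apply: differentiable_rV => k.
rewrite (_ : (fun y => _) =
  (fun y : 'rV[K]_n.+1 => (y 0 i)^-1 : K) * (fun y => y 0 (lift i k) : K)); last first.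
  by apply/funext => y; rewrite !mxE.
apply: differentiableM; last exact: differentiable_coord.
by apply: differentiableV => //; exact: differentiable_coord.
Qed.

Lemma proj_transition i j L : proj_dom i L -> proj_dom j L ->
  differentiable (proj_chart j \o proj_param i) (proj_chart i L).
Proof.
move=> Li Lj; rewrite (_ : _ \o _ =
  (fun z : 'rV[K]_n.+1 => col' j ((z 0 j)^-1 *: z)) \o proj_hom i); last first.
  by apply/funext => w /=; rewrite proj_chart_class ?proj_hom_neq0.
apply: differentiable_comp; first exact: differentiable_proj_hom.
apply: differentiable_chart_class.
by rewrite -proj_dom_class ?proj_hom_neq0 // -/(proj_param _ _) proj_chartK.
Qed.

Lemma open_coord_neq0 (i : 'I_n.+1) : open [set z : 'rV[K]_n.+1 | z 0 i != 0].
Proof.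
apply: (@open_comp _ _ (fun z : 'rV[K]_n.+1 => z 0 i : K) [set x | x != 0]).
  by move=> z _; exact: coord_continuous.
rewrite (_ : [set _ | _] = ~` [set 0]); last first.
  by apply/seteqP; split => z /= /eqP.
exact/closed_openC/accessible_closed_set1/hausdorff_accessible/norm_hausdorff.
Qed.

Lemma proj_dom_open i : open (proj_dom i).
Proof.
rewrite proj_openE /proj_open.
suff -> : [set z : 'rV[K]_n.+1 | z != 0 /\ proj_dom i (pclass z)] =
    [set z : 'rV[K]_n.+1 | z 0 i != 0] by exact: open_coord_neq0.
apply/seteqP; split => z /=; first by move=> [z0]; rewrite proj_dom_class.
move=> zi; have z0 : z != 0 by apply: contraNneq zi => ->; rewrite mxE.
by rewrite proj_dom_class.
Qed.

Lemma proj_cover L : exists i, proj_dom i L.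
Proof.
by have /rV0Pn[i Li] := pline_neq0 L; exists i.
Qed.

Lemma proj_chart_img i : proj_chart i @` proj_dom i = setT.
Proof.
apply/seteqP; split => // w _; exists (proj_param i w); last exact: proj_paramK.
by rewrite proj_dom_class ?proj_hom_neq0 // proj_hom_i oner_neq0.
Qed.

Lemma proj_chart_cont i L : proj_dom i L -> {for L, continuous (proj_chart i)}.
Proof.
move=> Li A; rewrite /= nbhsE => -[B [oB BL] BA].
exists (proj_dom i `&` proj_chart i @^-1` B); split.
- change (proj_open (proj_dom i `&` proj_chart i @^-1` B)).
  rewrite /proj_open openE => z /= [z0].
  rewrite proj_dom_class // proj_chart_class // => -[zi Bz].
  have := differentiable_continuous (differentiable_chart_class zi).
  move=> /(_ B (open_nbhs_nbhs (conj oB Bz))) nB.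
  have nz : nbhs z [set z | z 0 i != 0].
    by apply: open_nbhs_nbhs; split => //; exact: open_coord_neq0.
  apply: filterS2 nz nB => y /= yi By.
  have y0 : y != 0 by apply: contraNneq yi => ->; rewrite mxE.
  by rewrite proj_dom_class // proj_chart_class.
- by [].
- by move=> M [_ /BA].
Qed.

Lemma proj_param_cont i w : {for w, continuous (proj_param i)}.
Proof.
move=> A; rewrite /= nbhsE => -[B [oB Bw] BA].
pose D := [set z : 'rV[K]_n.+1 | z != 0 /\ B (pclass z)].
have nD : nbhs (proj_hom i w) D.
  by apply: open_nbhs_nbhs; split; [exact: oB|split; [exact: proj_hom_neq0|]].
have /(_ _ nD) h := differentiable_continuous (differentiable_proj_hom i w).
change (nbhs w (proj_param i @^-1` A)); change (nbhs w (proj_hom i @^-1` D)) in h.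
by apply: filterS h => v [_ /BA].
Qed.

Fact proj_img_open i : open (proj_chart i @` proj_dom i).
Proof. by rewrite proj_chart_img; exact: openT. Qed.

Definition projective_space : cmanifold K n :=
  @CManifold K n projspace 'I_n.+1 proj_dom proj_chart proj_param
    proj_cover proj_dom_open proj_img_open proj_chartK proj_chart_cont
    (fun i L _ => @proj_param_cont i _) proj_transition.

End Projective.

Section Embedding.
Variable K : numFieldType.

(* With the index shift of [H3], calW is F_2 + F_3 and h3e K 0 is e_1. *)
Definition calW : set (H3 K) :=
  [set x + y | x in @calF K 1 & y in @calF K 2].

Definition jvec (x : H3 K) : H3 K := h3e K 0 + x - cross (h3e K 0) (sharp x).

Definition jmap (x : H3 K) : projspace K 26 := pclass (jvec x).

Definition calP : set (projspace K 26) :=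
  [set L | exists z : H3 K, [/\ z != 0, sharp z = 0 & L = pclass z]].

Lemma cross_e_diag (z : H3 K) : h3diag (cross (h3e K 0) z) 0 = 0.
Proof.
rewrite /cross !h3diagB !h3_diag !h3diagD !h3octD !h3_diag !h3_oct !add0r.
have -> : onorm (0 : oct K) = 0.
  by rewrite /onorm big1 // => i _; rewrite mxE expr0n.
by rewrite mul0r subrr subr0 subrr.
Qed.

Lemma jvec_neq0 x : calW x -> jvec x != 0.
Proof.
move=> [_ [a _ <-] [_ [b _ <-] <-]]; apply/eqP.
move=> /(congr1 (fun z => h3diag z 0))/eqP.
rewrite /jvec h3diagB cross_e_diag !h3diagD !h3_diag /h3diag !mxE /=.
by rewrite !addr0 subr0 oner_eq0.
Qed.

End Embedding.
Arguments biholomorphism {K m n} M N A B f.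
Arguments calW K : clear implicits.
Arguments calP K : clear implicits.

(* Main.v *)
Require Import Defs.
From mathcomp Require Import all_boot all_order all_algebra.
From mathcomp Require Import all_classical all_reals all_analysis.
From mathcomp Require Import complex ring.
(* If z^# = 0 and alpha_1 = 1, the equations z^# = 0 determine alpha_2, alpha_3
   and a_1 polynomially from a_2 and a_3, and z = j(F_2(a_2) + F_3(a_3));
   conversely composition-algebra identities give j(x)^# = 0.  So j(W) is the
   part of P where alpha_1 <> 0, and j^-1 is z |-> (a_2, a_3) / alpha_1, the
   restriction of a linear map in an affine chart.  For density, the congruence
   by 1 + u E_12 preserves z^# = 0 and adds (u : a_3) + n(u) alpha_2 to alpha_1;
   for small u, its cyclic rotations move any point of P first to points with
   some alpha_i <> 0 and then to points with alpha_1 <> 0. *)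

Set Implicit Arguments.
Unset Strict Implicit.
Unset Printing Implicit Defensive.
Import Order.TTheory GRing.Theory Num.Theory.
Import numFieldNormedType.Exports.
Local Open Scope classical_set_scope.
Local Open Scope ring_scope.

(** * Linear structure and unit under Cayley-Dickson doubling *)

Section CayleyDickson.
Variable K : comNzRingType.

(** These properties pass through the doubling without any associativity. Multiplicativity of the
    norm does not, and comes from [onorm_mul] instead. *)
Record cd_unital n (mul : 'rV[K]_n.+1 -> 'rV[K]_n.+1 -> 'rV[K]_n.+1)
    (conj : 'rV[K]_n.+1 -> 'rV[K]_n.+1) : Prop := CDUnital {
  cd_mulDl : forall x y z, mul (x + y) z = mul x z + mul y z;
  cd_mulZl : forall k x y, mul (k *: x) y = k *: mul x y;
  cd_mulDr : forall x y z, mul x (y + z) = mul x y + mul x z;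
  cd_mulZr : forall k x y, mul x (k *: y) = k *: mul x y;
  cd_mul1l : forall x, mul (delta_mx 0 0) x = x;
  cd_mul1r : forall x, mul x (delta_mx 0 0) = x;
  cd_conjE : forall x, conj x = (x 0 0 *+ 2) *: delta_mx 0 0 - x }.

Lemma delta_mx00_row n :
  delta_mx 0 0 = row_mx (delta_mx 0 0) 0 :> 'rV[K]_(n.+1 + n.+1).
Proof.
rewrite -[LHS](@hsubmxK _ _ n.+1 n.+1); congr row_mx; apply/matrixP => i j;
by rewrite !mxE //= -!val_eqE /= ?andbF.
Qed.

Lemma cd_unital_double n mul conj : @cd_unital n mul conj ->
  @cd_unital (n + n.+1) (cd_mul mul conj) (cd_conj conj).
Proof.
move=> [Dl Zl Dr Zr m1l m1r cE].
have m0l x : mul 0 x = 0 by have := Zl 0 0 x; rewrite !scale0r.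
have m0r x : mul x 0 = 0 by have := Zr 0 x 0; rewrite !scale0r.
have cD x y : conj (x + y) = conj x + conj y.
  by rewrite !cE mxE mulrnDl scalerDl opprD addrACA.
have cZ k x : conj (k *: x) = k *: conj x.
  by rewrite !cE mxE -mulrnAr scalerBr scalerA.
have c1 : conj (delta_mx 0 0) = delta_mx 0 0.
  by rewrite cE mxE mulr2n scalerDl scale1r addrK.
have c0 : conj 0 = 0 by have := cZ 0 0; rewrite !scale0r.
have lD := raddfD (@lsubmx K 1 n.+1 n.+1).
have rD := raddfD (@rsubmx K 1 n.+1 n.+1).
have lZ k (x : 'rV[K]_(n.+1 + n.+1)) : lsubmx (k *: x) = k *: lsubmx x.
  by rewrite linearZ.
have rZ k (x : 'rV[K]_(n.+1 + n.+1)) : rsubmx (k *: x) = k *: rsubmx x.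
  by rewrite linearZ.
(* The doubled algebra lives in dimension [(n + n.+1).+1], which is only convertible to
   [n.+1 + n.+1]; the block-row laws are restated at that type. *)
have rowD (a b c d : 'rV[K]_n.+1) : row_mx a b + row_mx c d =
    row_mx (a + c) (b + d) :> 'rV[K]_(n + n.+1).+1 := add_row_mx a b c d.
have rowZ k (a b : 'rV[K]_n.+1) : k *: row_mx a b =
    row_mx (k *: a) (k *: b) :> 'rV[K]_(n + n.+1).+1 := scale_row_mx k a b.
have rowN (a b : 'rV[K]_n.+1) : - row_mx a b =
    row_mx (- a) (- b) :> 'rV[K]_(n + n.+1).+1 := opp_row_mx a b.
have rowE (a b c d : 'rV[K]_n.+1) : a = c -> b = d ->
    row_mx a b = row_mx c d :> 'rV[K]_(n + n.+1).+1 by move=> -> ->.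
split=> [x y z|k x y|x y z|k x y|x|x|x]; rewrite /cd_mul /cd_conj.
- rewrite lD rD !Dl !Dr rowD; apply: rowE; last by rewrite addrACA.
  by rewrite opprD addrACA.
- by rewrite lZ rZ !Zl !Zr rowZ scalerBr scalerDr.
- rewrite lD rD !(Dl, Dr, cD) rowD; apply: rowE; last by rewrite addrACA.
  by rewrite opprD addrACA.
- by rewrite lZ rZ !(Zl, Zr, cZ) rowZ scalerBr scalerDr.
- rewrite delta_mx00_row row_mxKl row_mxKr !(m1l, m1r, m0l, m0r).
  by rewrite subr0 addr0 hsubmxK.
- rewrite delta_mx00_row row_mxKl row_mxKr !(m1l, m1r, c0, c1, m0l, m0r).
  by rewrite subr0 add0r hsubmxK.
- rewrite delta_mx00_row cE rowZ.
  rewrite -[in X in _ = _ - X](@hsubmxK _ _ n.+1 n.+1 x) rowN rowD.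
  rewrite scaler0 add0r mxE.
  by apply: rowE; rewrite ?sub0r //; congr ((x _ _ *+ 2) *: _ - _); apply: val_inj.
Qed.

Lemma oct_unital : @cd_unital 7 (@omul K) (@oconj K).
Proof.
have u1 : @cd_unital 0 (@mul1 K) (@conj1 K).
  have d1 : delta_mx 0 0 = 1%:M :> 'M[K]_1.
    by apply/matrixP => i j; rewrite !mxE !ord1.
  split=> [x y z|k x y|x y z|k x y|x|x|x]; rewrite /mul1 /conj1 ?d1.
  - exact: mulmxDl.
  - by rewrite -scalemxAl.
  - exact: mulmxDr.
  - by rewrite -scalemxAr.
  - exact: mul1mx.
  - exact: mulmx1.
  - apply/matrixP => i j; rewrite !ord1 !mxE mulr1 mulr2n; exact/esym/addrK.
exact: (cd_unital_double (cd_unital_double (cd_unital_double u1))).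
Qed.

End CayleyDickson.

(** * Identities in composition algebras and the equations of the null cone *)

Section CompositionAlgebra.
Variables (K : numFieldType) (V : lmodType K).

(** Here [dot] is half of the polar form, so that the norm is [dot x x]. It is bilinear, and over
    the complex numbers nonzero vectors can be isotropic: the axioms ask for nondegeneracy
    ([comp_dot_inj]), not positivity. *)
Record composition (mul : V -> V -> V) (one : V) (dot : V -> V -> K) : Prop :=
  Composition {
    comp_mulDl : forall x y z, mul (x + y) z = mul x z + mul y z;
    comp_mulZl : forall k x y, mul (k *: x) y = k *: mul x y;
    comp_mulDr : forall x y z, mul x (y + z) = mul x y + mul x z;
    comp_mulZr : forall k x y, mul x (k *: y) = k *: mul x y;
    comp_mul1l : forall x, mul one x = x;
    comp_mul1r : forall x, mul x one = x;
    comp_dotC : forall x y, dot x y = dot y x;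
    comp_dotDl : forall x y z, dot (x + y) z = dot x z + dot y z;
    comp_dotZl : forall k x y, dot (k *: x) y = k * dot x y;
    comp_dot_inj : forall x y, (forall w, dot x w = dot y w) -> x = y;
    comp_dot11 : dot one one = 1;
    comp_normM : forall x y, dot (mul x y) (mul x y) = dot x x * dot y y }.

Variables (mul : V -> V -> V) (one : V) (dot : V -> V -> K).
Hypothesis comp : composition mul one dot.
Implicit Types (k : K) (x y z u v w : V).

Local Notation "x ** y" := (mul x y) (at level 40, left associativity).
Local Notation norm x := (dot x x).

Definition cconj x : V := (dot one x *+ 2) *: one - x.

Let mulDl := comp_mulDl comp.
Let mulZl := comp_mulZl comp.
Let mulDr := comp_mulDr comp.
Let mulZr := comp_mulZr comp.
Let mul1l := comp_mul1l comp.
Let mul1r := comp_mul1r comp.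
Let dotC := comp_dotC comp.
Let dotDl := comp_dotDl comp.
Let dotZl := comp_dotZl comp.
Let dot_inj := comp_dot_inj comp.
Let dot11 := comp_dot11 comp.
Let normM := comp_normM comp.

Let mulNl x y : - x ** y = - (x ** y).
Proof. by rewrite -scaleN1r mulZl scaleN1r. Qed.
Let mulNr x y : x ** - y = - (x ** y).
Proof. by rewrite -scaleN1r mulZr scaleN1r. Qed.
Let dotDr x y z : dot x (y + z) = dot x y + dot x z.
Proof. by rewrite !(dotC x) dotDl. Qed.
Let dotZr k x y : dot x (k *: y) = k * dot x y.
Proof. by rewrite !(dotC x) dotZl. Qed.
Let dotNl x y : dot (- x) y = - dot x y.
Proof. by rewrite -scaleN1r dotZl mulN1r. Qed.
Let dotNr x y : dot x (- y) = - dot x y.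
Proof. by rewrite -scaleN1r dotZr mulN1r. Qed.

Lemma cconjD x y : cconj (x + y) = cconj x + cconj y.
Proof. by rewrite /cconj dotDr mulrnDl scalerDl opprD addrACA. Qed.
Lemma cconjZ k x : cconj (k *: x) = k *: cconj x.
Proof. by rewrite /cconj dotZr -mulrnAr scalerBr scalerA. Qed.
Lemma cconjK : involutive cconj.
Proof.
move=> x; rewrite /cconj !(dotDr, dotZr, dotNr) dot11 mulr1 -scaleN1r.
by rewrite mulr2n addrK scalerDl scaleN1r opprB addrC subrK.
Qed.

Let normD x y : norm (x + y) = norm x + norm y + dot x y *+ 2.
Proof. rewrite !(dotDl, dotDr) (dotC y x); ring. Qed.

(** Polarization of [normM] in the left factor; the 2 cancels because a [numFieldType] has
    characteristic 0. *)
Let dot_mul_r x y z : dot (x ** z) (y ** z) = dot x y * norm z.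
Proof.
have := normM (x + y) z; rewrite mulDl !normD !normM !mulrDl.
by move=> /addrI; rewrite -mulr2n => /(pmulrnI (isT : (0 < 2)%N)).
Qed.

Let dot_mul_l x y z : dot (x ** y) (x ** z) = norm x * dot y z.
Proof.
have := normM x (y + z); rewrite mulDr !normD !normM !mulrDr.
by move=> /addrI; rewrite -mulr2n => /(pmulrnI (isT : (0 < 2)%N)).
Qed.

Let dot_mul_polar x y z w :
  dot (x ** y) (z ** w) + dot (x ** w) (z ** y) = dot x z * dot y w *+ 2.
Proof.
have := dot_mul_r x z (y + w).
rewrite !mulDr !(dotDl, dotDr) !dot_mul_r (dotC w y) => E.
apply: (addrI (dot x z * norm y + dot x z * norm w)).
transitivity (dot x z * (norm y + dot y w + (dot y w + norm w))); last by ring.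
rewrite -E; ring.
Qed.

(** Case [z = one] of the full polarization. With [dot_inj], adjoints let identities between
    products be checked against the form, without associativity. *)
Let dot_adj_l x y z : dot (x ** y) z = dot y (cconj x ** z).
Proof.
have := dot_mul_polar x y one z; rewrite !mul1l (dotC x one) => E.
rewrite /cconj mulDl mulNl mulZl mul1l dotDr dotNr dotZr (dotC y (x ** z)).
by rewrite -mulrnAl in E; rewrite -E addrK.
Qed.

Let dot_adj_r x y z : dot (x ** y) z = dot x (z ** cconj y).
Proof.
have := dot_mul_polar x y z one; rewrite !mul1r (dotC y one) => E.
rewrite /cconj mulDr mulNr mulZr mul1r dotDr dotNr dotZr.
by rewrite mulrC -mulrnAr mulrC in E; rewrite mulrnAl -mulrnAr mulrC -E addrK.
Qed.

Lemma dot_conj x y : dot (cconj x) (cconj y) = dot x y.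
Proof.
rewrite /cconj !(dotDl, dotDr, dotNl, dotNr, dotZl, dotZr) dot11 (dotC x one).
ring.
Qed.

(** Moving factors by adjunction, both sides pair with [w] to [dot x (cconj w ** cconj y)]. *)
Lemma cconjM x y : cconj (x ** y) = cconj y ** cconj x.
Proof.
apply: dot_inj => w; rewrite -[w in LHS]cconjK dot_conj dot_adj_r.
by rewrite [RHS]dot_adj_r cconjK [RHS]dotC dot_adj_l.
Qed.

(** A weak substitute for associativity: it is [dot_mul_l] read through the adjoint. *)
Lemma mul_conjK x y : cconj x ** (x ** y) = norm x *: y.
Proof.
by apply: dot_inj => w; rewrite dot_adj_l cconjK dot_mul_l dotZl.
Qed.

Lemma mulK_conj x y : (x ** y) ** cconj y = norm y *: x.
Proof.
by apply: dot_inj => w; rewrite dot_adj_r cconjK dot_mul_r dotZl mulrC.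
Qed.

Lemma mul_conj_polar u v y :
  cconj u ** (v ** y) + cconj v ** (u ** y) = (dot u v *+ 2) *: y.
Proof.
have := mul_conjK (u + v) y; rewrite cconjD (mulDl u) (mulDl (cconj u)).
rewrite !mulDr !mul_conjK normD.
rewrite !scalerDl => E; apply: (addrI (norm u *: y + norm v *: y)).
rewrite -E -!addrA; congr (_ + _); rewrite addrCA; congr (_ + _).
by rewrite addrC.
Qed.

(** Cyclic invariance of the trilinear form [dot u (cconj (x ** y))], which is half the trace of
    [u ** (x ** y)]. *)
Lemma dot_triple u x y : dot u (cconj (x ** y)) = dot y (cconj (u ** x)).
Proof.
by rewrite -(dot_conj u) cconjK dotC dot_adj_l cconjM.
Qed.

(** The six components of z^# = 0, with free coordinates so that the cyclic symmetry of H_3 is a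
    rotation of the arguments. *)
Definition null_coords (a1 a2 a3 : K) (x1 x2 x3 : V) : Prop :=
  [/\ a2 * a3 = norm x1, a3 * a1 = norm x2 & a1 * a2 = norm x3] /\
  [/\ cconj (x2 ** x3) = a1 *: x1, cconj (x3 ** x1) = a2 *: x2 &
      cconj (x1 ** x2) = a3 *: x3].

Lemma null_coords_rot a1 a2 a3 x1 x2 x3 :
  null_coords a1 a2 a3 x1 x2 x3 -> null_coords a2 a3 a1 x2 x3 x1.
Proof. by move=> [[s1 s2 s3] [q1 q2 q3]]. Qed.

Lemma null_coordsZ k a1 a2 a3 x1 x2 x3 : null_coords a1 a2 a3 x1 x2 x3 ->
  null_coords (k * a1) (k * a2) (k * a3) (k *: x1) (k *: x2) (k *: x3).
Proof.
move=> [[s1 s2 s3] [q1 q2 q3]]; split; split.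
- by rewrite dotZl dotZr -s1; ring.
- by rewrite dotZl dotZr -s2; ring.
- by rewrite dotZl dotZr -s3; ring.
- by rewrite mulZl mulZr !cconjZ q1 !scalerA; congr (_ *: _); ring.
- by rewrite mulZl mulZr !cconjZ q2 !scalerA; congr (_ *: _); ring.
- by rewrite mulZl mulZr !cconjZ q3 !scalerA; congr (_ *: _); ring.
Qed.

(** Three of the equations define the entries [norm x], [norm y] and [cconj (x ** y)]. The other
    three are multiplicativity of the norm and the cancellation laws [mulK_conj] and [mul_conjK]. *)
Lemma null_coords_affine x y :
  null_coords 1 (norm y) (norm x) (cconj (x ** y)) x y.
Proof.
split; split.
- by rewrite dot_conj normM mulrC.
- by rewrite mulr1.
- by rewrite GRing.mul1r.
- by rewrite scale1r.
- by rewrite cconjM cconjK mulK_conj.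
- by rewrite cconjM cconjK mul_conjK.
Qed.

(* The congruence by the elementary matrix 1 + u E_12, which preserves the cone
   z^# = 0. *)
Lemma null_coords_shear u a1 a2 a3 x1 x2 x3 : null_coords a1 a2 a3 x1 x2 x3 ->
  null_coords (a1 + dot u x3 *+ 2 + norm u * a2) a2 a3
    x1 (x2 + cconj (u ** x1)) (x3 + a2 *: u).
Proof.
move=> [[s1 s2 s3] [q1 q2 q3]]; split; split => //.
(* By cyclic invariance and [q3], the cross term [dot x2 (cconj (u ** x1))] equals
   [a3 * dot u x3]. *)
- rewrite normD -(dot_triple u x1 x2) q3 dotZr dot_conj normM -s1 -s2; ring.
- rewrite normD !dotZl !dotZr -s3 (dotC x3 u); ring.
- have cM y z : cconj (cconj y ** z) = cconj z ** y by rewrite cconjM cconjK.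
  rewrite (mulDl x2) !(mulDr _ x3) !mulZr !cconjD !cconjZ q1 !cM.
  (* Through [q2] the term in [x2 ** u] becomes [cconj u ** (x3 ** x1)], which combines with
     [cconj x3 ** (u ** x1)] under [mul_conj_polar]. *)
  rewrite cconjM -(mulZr a2) -cconjZ -q2 cconjK mul_conjK scalerA.
  rewrite -addrA [_ *: x1 + (_ + _)]addrC -!addrA addrA mul_conj_polar.
  by rewrite -!scalerDl; congr (_ *: _); ring.
- by rewrite (mulDl x3) mulZl cconjD cconjZ q2 [RHS]scalerDr.
- rewrite (mulDr x1) cconjD q3 [RHS]scalerDr [cconj (x1 ** cconj _)]cconjM cconjK.
  by rewrite mulK_conj -s1 scalerA [a2 * a3]mulrC.
Qed.

End CompositionAlgebra.

(** * Octonions as a composition algebra *)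

Section Octonions.
Variable K : numFieldType.
Implicit Types (k : K) (x y z u v w : oct K).

(* Half of the form (x : y). *)
Definition odot x y : K := \sum_(i < 8) x 0 i * y 0 i.

Lemma onormE x : onorm x = odot x x.
Proof. by apply: eq_bigr => i _; rewrite expr2. Qed.

Lemma odot1 x : odot (oone K) x = x 0 0.
Proof.
rewrite /odot (bigD1 0) //= mxE !eqxx mul1r big1 ?addr0 // => i /negPf i0.
by rewrite mxE i0 andbF mul0r.
Qed.

Lemma odot_delta x i : odot x (delta_mx 0 i) = x 0 i.
Proof.
rewrite /odot (bigD1 i) //= mxE !eqxx mulr1 big1 ?addr0 // => j /negPf ji.
by rewrite mxE ji andbF mulr0.
Qed.

Lemma oct_composition : composition (@omul K) (oone K) odot.
Proof.
have [Dl Zl Dr Zr m1l m1r _] := oct_unital K.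
split; [exact: Dl | exact: Zl | exact: Dr | exact: Zr | exact: m1l | exact: m1r
  | move=> x y | move=> x y z | move=> k x y | move=> x y xy | | move=> x y].
- by apply: eq_bigr => i _; rewrite mulrC.
- by rewrite -big_split; apply: eq_bigr => i _; rewrite mxE mulrDl.
- by rewrite mulr_sumr; apply: eq_bigr => i _; rewrite mxE mulrA.
- by apply/rowP => i; rewrite -!odot_delta.
- by rewrite odot1 mxE.
- by rewrite -(onormE x) -(onormE y) -onormE onorm_mul.
Qed.

Lemma oconjE x : oconj x = cconj (oone K) odot x.
Proof. by rewrite (cd_conjE (oct_unital K)) /cconj odot1. Qed.

(** Shows the product to be polynomial in the coordinates, for its differentiability below. *)
Lemma omul_sum x y : omul x y =
  \sum_(i < 8) \sum_(j < 8) (x 0 i * y 0 j) *: omul (delta_mx 0 i) (delta_mx 0 j).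
Proof.
have mulsl I (r : seq I) (P : pred I) (F : I -> oct K) v :
    omul (\sum_(i <- r | P i) F i) v = \sum_(i <- r | P i) omul (F i) v.
  apply: (big_morph (fun u => omul u v)) => [u w|].
    exact: comp_mulDl oct_composition u w v.
  by have := comp_mulZl oct_composition 0 0 v; rewrite !scale0r.
have mulsr I (r : seq I) (P : pred I) (F : I -> oct K) v :
    omul v (\sum_(i <- r | P i) F i) = \sum_(i <- r | P i) omul v (F i).
  apply: (big_morph (fun u => omul v u)) => [u w|].
    exact: comp_mulDr oct_composition v u w.
  by have := comp_mulZr oct_composition 0 v 0; rewrite !scale0r.
rewrite {1}(row_sum_delta x) mulsl; apply: eq_bigr => i _.
rewrite {1}(row_sum_delta y) mulsr; apply: eq_bigr => j _.
rewrite (comp_mulZl oct_composition) (comp_mulZr oct_composition).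
by rewrite scalerA.
Qed.

End Octonions.

Arguments oct_composition {K}.

(** * The cone z^# = 0 and the image of j *)

Section NullCone.
Variable K : numFieldType.
Implicit Types (x z w : H3 K) (a b u : oct K) (i k : 'I_3).

Lemma ord3_ind (P : 'I_3 -> Prop) : P 0 -> P 1 -> P 2 -> forall i, P i.
Proof.
move=> P0 P1 P2 [[|[|[|//]]] lti].
- by rewrite (_ : Ordinal lti = 0) //; apply: val_inj.
- by rewrite (_ : Ordinal lti = 1) //; apply: val_inj.
- by rewrite (_ : Ordinal lti = 2) //; apply: val_inj.
Qed.

Lemma h3P z w : (forall i, h3diag z i = h3diag w i) ->
  (forall i, h3oct z i = h3oct w i) -> z = w.
Proof.
move=> dzw ozw; rewrite -(h3K z) -(h3K w).
by congr h3; apply/funext.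
Qed.

Lemma h3diag0 i : h3diag (0 : H3 K) i = 0.
Proof. by rewrite /h3diag !mxE. Qed.

Lemma h3oct0 i : h3oct (0 : H3 K) i = 0.
Proof. by apply/rowP => j; rewrite !mxE. Qed.

Lemma h3diagZ (c : K) z i : h3diag (c *: z) i = c * h3diag z i.
Proof. by rewrite /h3diag !mxE. Qed.

Lemma h3octZ (c : K) z i : h3oct (c *: z) i = c *: h3oct z i.
Proof. by apply/rowP => j; rewrite !mxE. Qed.

Lemma h3octB z w i : h3oct (z - w) i = h3oct z i - h3oct w i.
Proof. by apply/rowP => j; rewrite !mxE. Qed.

Lemma h3diag_ord0 z : h3diag z 0 = z 0 0.
Proof. by rewrite /h3diag mxE; congr (z _ _); apply: val_inj. Qed.

(** The starting index is kept as a parameter so that a shear can be applied at any of the three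
    positions. *)
Definition null z i := null_coords (@omul K) (oone K) (@odot K)
  (h3diag z i) (h3diag z (i + 1)) (h3diag z (i + 2))
  (h3oct z i) (h3oct z (i + 1)) (h3oct z (i + 2)).

Let add12 i : i + 1 + 1 = i + 2.
Proof. by rewrite -addrA; congr (_ + _); apply: val_inj. Qed.
Let add11 i : i + 1 + 2 = i.
Proof. by rewrite -addrA -[RHS]addr0; congr (_ + _); apply: val_inj. Qed.
Let add21 i : i + 2 + 1 = i.
Proof. by rewrite -addrA -[RHS]addr0; congr (_ + _); apply: val_inj. Qed.
Let add22 i : i + 2 + 2 = i + 1.
Proof. by rewrite -addrA; congr (_ + _); apply: val_inj. Qed.

Lemma nullS z i : null z i -> null z (i + 1).
Proof. by move=> /null_coords_rot; rewrite /null add12 add11. Qed.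

Lemma sharp_eq0P z i : sharp z = 0 <-> null z i.
Proof.
have sd k : h3diag (sharp z) k =
    h3diag z (k + 1) * h3diag z (k + 2) - odot (h3oct z k) (h3oct z k).
  by rewrite h3_diag onormE.
have so k : h3oct (sharp z) k =
    cconj (oone K) (@odot K) (omul (h3oct z (k + 1)) (h3oct z (k + 2))) -
    h3diag z k *: h3oct z k by rewrite h3_oct oconjE.
split=> [z0|nz].
  have d k := sd k; have q k := so k.
  move: d q; rewrite z0 => d q; rewrite /null.
  have d' k : h3diag z (k + 1) * h3diag z (k + 2) = odot (h3oct z k) (h3oct z k).
    by apply/eqP; rewrite -subr_eq0 -d h3diag0.
  have q' k : cconj (oone K) (@odot K) (omul (h3oct z (k + 1)) (h3oct z (k + 2)))
      = h3diag z k *: h3oct z k.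
    by apply/eqP; rewrite -subr_eq0 -q h3oct0.
  split; split => //.
  - by have := d' (i + 1); rewrite add12 add11.
  - by have := d' (i + 2); rewrite add21 add22.
  - by have := q' (i + 1); rewrite add12 add11.
  - by have := q' (i + 2); rewrite add21 add22.
(* Two rotations carry the equations from [i] to every other starting index. *)
have {i nz} nz k : null z k.
  have nz1 := nullS nz; have nz2 := nullS nz1; rewrite add12 in nz2.
  suff : k = i \/ k = i + 1 \/ k = i + 2 by move=> [->|[->|->]].
  by elim/ord3_ind: k; elim/ord3_ind: i {nz nz1 nz2};
    do [by left; apply: val_inj | by right; left; apply: val_inj
       | by right; right; apply: val_inj].
by apply: h3P => k; rewrite (h3diag0, h3oct0) (sd, so);
  have [[d _ _] [q _ _]] := nz k; rewrite (d, q) subrr.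
Qed.

Lemma sharpZ_eq0 (c : K) z : sharp z = 0 -> sharp (c *: z) = 0.
Proof.
move=> /(sharp_eq0P _ 0) nz; apply/(sharp_eq0P _ 0).
rewrite /null !h3diagZ !h3octZ; exact (null_coordsZ oct_composition c nz).
Qed.

Definition projW z : H3 K := h3F 1 (h3oct z 1) + h3F 2 (h3oct z 2).

(** The value of [jvec] at [projW z], with [alpha_2 = n(a_3)] and [alpha_3 = n(a_2)]. It is
    polynomial and nonzero on all of V, hence a good extension of j off W; [jvec] itself vanishes at
    -e_1. *)
Definition emb z : H3 K :=
  h3 (fun i => if i == 0 then 1 else
               if i == 1 then onorm (h3oct z 2) else onorm (h3oct z 1))
     (fun i => if i == 0 then oconj (omul (h3oct z 1) (h3oct z 2))
               else h3oct z i).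

Lemma h3octF k a i : h3oct (h3F k a) i = if i == k then a else 0.
Proof. by rewrite h3_oct. Qed.

Lemma h3diagF k a i : h3diag (h3F k a) i = 0.
Proof. by rewrite h3_diag. Qed.

Lemma h3e_diag k i : h3diag (h3e K k) i = (i == k)%:R.
Proof. by rewrite h3_diag. Qed.

Lemma h3e_oct k i : h3oct (h3e K k) i = 0.
Proof. by rewrite h3_oct. Qed.

Lemma sharp_diag z i : h3diag (sharp z) i =
  h3diag z (i + 1) * h3diag z (i + 2) - onorm (h3oct z i).
Proof. by rewrite h3_diag. Qed.

Lemma sharp_oct z i : h3oct (sharp z) i =
  oconj (omul (h3oct z (i + 1)) (h3oct z (i + 2))) - h3diag z i *: h3oct z i.
Proof. by rewrite h3_oct. Qed.

Lemma projW_diag z i : h3diag (projW z) i = 0.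
Proof. by rewrite h3diagD !h3diagF addr0. Qed.

Lemma projW_oct z i : h3oct (projW z) i = if i == 0 then 0 else h3oct z i.
Proof.
rewrite h3octD !h3octF.
by elim/ord3_ind: i; rewrite /= ?addr0 ?add0r.
Qed.

Lemma projW_calW z : calW K (projW z).
Proof.
by exists (h3F 1 (h3oct z 1)); [exists (h3oct z 1) | exists (h3F 2 (h3oct z 2));
  [exists (h3oct z 2) | ]].
Qed.

Lemma projW_id x : calW K x -> projW x = x.
Proof.
move=> [_ [a _ <-] [_ [b _ <-] <-]].
by rewrite /projW !h3octD !h3octF /= addr0 add0r.
Qed.

Lemma projW_emb z : projW (emb z) = projW z.
Proof. by rewrite /projW !h3_oct. Qed.

(** For x in W, the diagonal of x^# is -n(a_i) and its F_1 part is the conjugate of a_2 a_3. The map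
    y |-> e_1 x y swaps the last two diagonal entries, negates the F_1 part and kills the rest. *)
Lemma jvec_projW z : jvec (projW z) = emb z.
Proof.
have n0 : onorm (0 : oct K) = 0.
  by rewrite /onorm big1 // => j _; rewrite mxE expr0n.
have m0 a : omul 0 a = 0.
  by have := comp_mulZl oct_composition 0 0 a; rewrite !scale0r.
have m0r a : omul a 0 = 0.
  by have := comp_mulZr oct_composition 0 a 0; rewrite !scale0r.
have c0 : oconj (0 : oct K) = 0.
  by rewrite !oconjE; have := cconjZ oct_composition (0 : K) 0; rewrite !scale0r.
have sD i : h3diag (sharp (projW z)) i = - onorm (h3oct (projW z) i).
  by rewrite sharp_diag !projW_diag mul0r add0r.
have sO i : h3oct (sharp (projW z)) i =
    oconj (omul (h3oct (projW z) (i + 1)) (h3oct (projW z) (i + 2))).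
  by rewrite sharp_oct projW_diag scale0r subr0.
have cD y i : h3diag (cross (h3e K 0) y) i =
    (i + 1 == 0)%:R * h3diag y (i + 2) + h3diag y (i + 1) * (i + 2 == 0)%:R.
  rewrite /cross !h3diagB !sharp_diag !h3diagD !h3octD !h3e_oct n0 add0r.
  rewrite !h3e_diag.
  have e0 : (i + 1 == 0)%:R * (i + 2 == 0)%:R = 0 :> K.
    by elim/ord3_ind: i; rewrite /= ?mul0r ?mulr0.
  by rewrite mulrDl !mulrDr e0; ring.
have cO y i : h3oct (cross (h3e K 0) y) i = - ((i == 0)%:R *: h3oct y i).
  rewrite /cross !h3octB !sharp_oct !h3diagD !h3octD !h3e_oct h3e_diag.
  rewrite m0 c0 scaler0 !add0r scalerDl !oppr0 addr0.
  by rewrite opprB opprD !addrA subrK addrAC subrr sub0r.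
apply: h3P => i.
  rewrite h3diagB h3diagD projW_diag cD !sD !projW_oct h3e_diag h3_diag addr0.
  have e22 : 2 + 2 = 1 :> 'I_3 by apply: val_inj.
  by elim/ord3_ind: i; rewrite /= ?e22 ?n0 ?oppr0 ?mul0r ?mulr0 ?mul1r ?mulr1
    ?addr0 ?subr0 ?sub0r ?add0r ?opprK.
rewrite h3octB h3octD cO sO !projW_oct h3e_oct h3_oct add0r opprK.
by elim/ord3_ind: i; rewrite /= ?scale1r ?scale0r ?addr0 ?add0r.
Qed.

Lemma emb_ord0 z : emb z 0 0 = 1.
Proof. by rewrite -h3diag_ord0 h3_diag. Qed.

Lemma emb_neq0 z : emb z != 0.
Proof. by apply: contra_eq_neq (emb_ord0 z) => ->; rewrite mxE eq_sym oner_neq0. Qed.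

Lemma sharp_emb z : sharp (emb z) = 0.
Proof.
apply/(sharp_eq0P _ 0); rewrite /null !h3_diag !h3_oct /= !onormE oconjE.
rewrite !add0r; exact: (null_coords_affine oct_composition (h3oct z 1)).
Qed.

(** Once alpha_1 = 1, the equations [s2], [s3] and [q1] solve for alpha_3, alpha_2 and a_1. *)
Lemma null_affine_emb z : sharp z = 0 -> z 0 0 = 1 -> z = emb z.
Proof.
move=> /(sharp_eq0P _ 0) [[_ s2 s3] [q1 _ _]].
rewrite -h3diag_ord0 => z1; rewrite z1 mulr1 mul1r scale1r in s2 s3 q1.
rewrite !add0r in s2 s3 q1.
apply: h3P => i; rewrite (h3_diag, h3_oct) ?onormE ?oconjE.
  by elim/ord3_ind: i.
by elim/ord3_ind: i.
Qed.

Lemma jmapE x : calW K x -> jmap x = pclass (emb x).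
Proof. by move=> /projW_id {1}<-; rewrite /jmap jvec_projW. Qed.

(** Coordinate 0 of the row vector is alpha_1, so a null point in the domain of chart 0 can be
    rescaled to alpha_1 = 1, where [null_affine_emb] applies. This also gives openness of the image
    in P. *)
Lemma image_jmap : @jmap K @` calW K = calP K `&` proj_dom 0.
Proof.
apply/seteqP; split=> [_ [x /jmapE -> <-]|_ [[z [z0 sz ->]]]].
  split; first by exists (emb x); rewrite emb_neq0 sharp_emb.
  by rewrite proj_dom_class ?emb_neq0 // emb_ord0 oner_neq0.
rewrite proj_dom_class // => z00.
pose w := (z 0 0)^-1 *: z.
have sw : sharp w = 0 by exact: sharpZ_eq0.
have w1 : w 0 0 = 1 by rewrite mxE mulVf.
exists (projW w); first exact: projW_calW.
by rewrite /jmap jvec_projW -null_affine_emb // pclassZ ?invr_neq0.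
Qed.
End NullCone.

(** * Differentiability of the polynomial maps *)

Section Analytic.
Variable K : numFieldType.

Section Differentiable.
Variable V : normedModType K.
Implicit Types (f g : V -> oct K) (t : V).

Lemma differentiable_coordf n (f : V -> 'rV[K]_n) t k :
  differentiable f t -> differentiable (fun y => f y 0 k : K) t.
Proof.
move=> df; apply: (@differentiable_comp _ _ _ _ f (fun z : 'rV[K]_n => z 0 k)) => //.
exact: differentiable_coord.
Qed.

Lemma differentiable_sumf n (F : 'I_n -> V -> K) t :
  (forall i, differentiable (F i) t) ->
  differentiable (fun y => \sum_(i < n) F i y) t.
Proof.
move=> dF; rewrite (_ : (fun _ => _) = \sum_(i < n) F i).
  exact: differentiable_sum.
by apply/funext => y; rewrite fct_sumE.
Qed.

Lemma differentiable_odot f g t : differentiable f t -> differentiable g t ->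
  differentiable (fun y => odot (f y) (g y) : K) t.
Proof.
move=> df dg; apply: differentiable_sumf => i.
by apply: differentiableM; exact: differentiable_coordf.
Qed.

Lemma differentiable_onorm f t : differentiable f t ->
  differentiable (fun y => onorm (f y) : K) t.
Proof.
move=> df; under eq_fun do rewrite onormE; exact: differentiable_odot.
Qed.

Lemma differentiable_omul f g t : differentiable f t -> differentiable g t ->
  differentiable (fun y => omul (f y) (g y)) t.
Proof.
move=> df dg; apply: differentiable_rV => k.
under eq_fun => y.
  rewrite omul_sum summxE; under eq_bigr => i _.
    rewrite summxE; under eq_bigr do rewrite mxE.
    over.
  over.
apply: differentiable_sumf => i; apply: differentiable_sumf => j.
apply: differentiableM; last exact: differentiable_cst.
by apply: differentiableM; exact: differentiable_coordf.
Qed.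

Lemma differentiable_oconj f t : differentiable f t ->
  differentiable (fun y => oconj (f y)) t.
Proof.
move=> df; under eq_fun do rewrite (cd_conjE (oct_unital K)).
apply: differentiableB => //; apply: differentiableZl.
under eq_fun do rewrite mulr2n.
by apply: differentiableD; exact: differentiable_coordf.
Qed.

Lemma differentiable_h3 (al : V -> 'I_3 -> K) (a : V -> 'I_3 -> oct K) t :
  (forall i, differentiable (fun y => al y i : K) t) ->
  (forall i, differentiable (fun y => a y i) t) ->
  differentiable (fun y => h3 (al y) (a y)) t.
Proof.
move=> dal da; apply: differentiable_rV => k.
have [j ->|j ->] := @split_ordP 3 (3 * 8) k.
  have E y : h3 (al y) (a y) 0 (lshift (3 * 8) j) = al y j.
    by apply: etrans (row_mxEl _ _ _ _) _; rewrite mxE.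
  by under eq_fun do rewrite E; exact: dal.
case/mxvec_indexP: j => i l.
have E y : h3 (al y) (a y) 0 (rshift 3 (mxvec_index i l)) = a y i 0 l.
  by apply: etrans (row_mxEr _ _ _ _) _; rewrite mxvecE mxE.
under eq_fun do rewrite E.
exact: differentiable_coordf.
Qed.

End Differentiable.

Lemma differentiable_h3oct i (z : H3 K) : differentiable (fun y : H3 K => h3oct y i) z.
Proof.
apply: differentiable_rV => k; under eq_fun do rewrite !mxE.
exact: differentiable_coord.
Qed.

Lemma differentiable_emb (z : H3 K) : differentiable (@emb K) z.
Proof.
apply: differentiable_h3; elim/ord3_ind => /=; try exact: differentiable_cst;
  try exact: differentiable_h3oct.
- by apply: differentiable_onorm; exact: differentiable_h3oct.
- by apply: differentiable_onorm; exact: differentiable_h3oct.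
- apply: differentiable_oconj.
  by apply: differentiable_omul; exact: differentiable_h3oct.
Qed.

Lemma differentiable_projW (z : H3 K) : differentiable (@projW K) z.
Proof.
rewrite /projW; apply: differentiableD; apply: differentiable_h3;
  elim/ord3_ind => /=; try exact: differentiable_cst;
  exact: differentiable_h3oct.
Qed.

(** * Density of the image by shears *)

Lemma continuous_pclass n (z : 'rV[K]_n.+1) : z != 0 ->
  {for z, continuous (@pclass K n)}.
Proof.
move=> z0 A; rewrite /= nbhsE => -[B [oB Bz] BA].
have nz : nbhs z [set w : 'rV[K]_n.+1 | w != 0 /\ B (pclass w)].
  by apply: open_nbhs_nbhs; split; [exact: oB | split].
change (nbhs z (@pclass K n @^-1` A)).
by apply: filterS nz => w [_ /BA].
Qed.

(** Congruence by 1 + u E_{i,i+1}, indices modulo 3: [null_coords_shear] rotated to position [i]. *)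
Definition shear (z : H3 K) (i : 'I_3) (u : oct K) : H3 K :=
  h3 (fun k => if k == i then
                 h3diag z i + odot u (h3oct z (i + 2)) *+ 2 +
                 odot u u * h3diag z (i + 1)
               else h3diag z k)
     (fun k => if k == i + 1 then h3oct z k + oconj (omul u (h3oct z i)) else
               if k == i + 2 then h3oct z k + h3diag z (i + 1) *: u
               else h3oct z k).

Lemma sharp_shear z i u : sharp z = 0 -> sharp (shear z i u) = 0.
Proof.
move=> /(sharp_eq0P _ i) nz; apply/(sharp_eq0P _ i).
have ne : [/\ (i + 1 == i) = false, (i + 2 == i) = false,
  (i == i + 1) = false, (i == i + 2) = false & (i + 2 == i + 1) = false].
  by elim/ord3_ind: i {nz}; split.
rewrite /null /shear !h3_diag !h3_oct !eqxx.
case: ne => -> -> -> -> ->; rewrite oconjE.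
exact (null_coords_shear oct_composition u nz).
Qed.

Lemma differentiable_shear z i u : differentiable (shear z i) u.
Proof.
have did : differentiable (fun u : oct K => u) u by exact: ex_diff.
apply: differentiable_h3 => k.
  case: (k == i); last exact: differentiable_cst.
  apply: differentiableD; last first.
    by apply: differentiableM; [exact: differentiable_odot|
      exact: differentiable_cst].
  apply: differentiableD; first exact: differentiable_cst.
  under eq_fun do rewrite mulr2n.
  by apply: differentiableD; apply: differentiable_odot => //;
    exact: differentiable_cst.
case: (k == i + 1).
  apply: differentiableD; first exact: differentiable_cst.
  by apply: differentiable_oconj; apply: differentiable_omul => //;
    exact: differentiable_cst.
case: (k == i + 2); last exact: differentiable_cst.
apply: differentiableD; first exact: differentiable_cst.
exact: differentiableZ.
Qed.

Lemma shear0 z i : shear z i 0 = z.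
Proof.
have o0 x : odot 0 x = 0 by rewrite /odot big1 // => j _; rewrite mxE mul0r.
apply: h3P => k; rewrite (h3_diag, h3_oct).
  by case: eqP => // ->; rewrite !o0 mul0rn mul0r !addr0.
rewrite scaler0 addr0.
have -> : omul 0 (h3oct z i) = 0.
  by have := comp_mulZl oct_composition 0 0 (h3oct z i); rewrite !scale0r.
rewrite oconjE.
have := cconjZ oct_composition (0 : K) 0; rewrite !scale0r => ->.
by rewrite addr0 !if_same.
Qed.

(** If alpha_i = 0, the shear by [t *: u] has i-th diagonal entry [t * a + t ^+ 2 * b]. For a
    suitable [u] this polynomial in [t] is nonzero, so it is nonzero at arbitrarily small [t]. *)
Lemma closure_shear z i : sharp z = 0 ->
  h3diag z (i + 1) != 0 \/ h3oct z (i + 2) != 0 ->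
  closure [set w : H3 K | sharp w = 0 /\ h3diag w i != 0] z.
Proof.
move=> sz zi.
have [d0|d0] := eqVneq (h3diag z i) 0; last exact: subset_closure.
(* When a_{i+2} = 0, [u = 1] makes the quadratic coefficient alpha_{i+1}; otherwise a basis vector
   at a nonzero coordinate of a_{i+2} makes the linear one nonzero. *)
have [u u0] : exists u, odot u (h3oct z (i + 2)) *+ 2 != 0 \/
    odot u u * h3diag z (i + 1) != 0.
  have [q0|q0] := eqVneq (h3oct z (i + 2)) 0.
    exists (oone K); right; move: zi; rewrite q0 eqxx => -[|//].
    by rewrite odot1 mxE eqxx mul1r.
  have /rV0Pn[j qj] := q0.
  exists (delta_mx 0 j); left.
  by rewrite (comp_dotC oct_composition) odot_delta mulrn_eq0.
move=> D zD.
have cS : {for 0, continuous (fun t : K => shear z i (t *: u))}.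
  apply: (@continuous_comp _ _ _ (fun t : K => t *: u) (shear z i)).
    exact: scalel_continuous.
  exact: differentiable_continuous (differentiable_shear _ _ _).
have /cS : nbhs (shear z i ((0 : K) *: u)) D by rewrite scale0r shear0.
move=> /nbhs_ballP[e /= e0 De].
have e2 : 0 < e / 2 by rewrite divr_gt0.
have be (t : K) : `|t| = e / 2 -> D (shear z i (t *: u)).
  move=> te; apply: De; rewrite /ball /= sub0r normrN te.
  by rewrite ltr_pdivrMr // ltr_pMr // ltr1n.
suff [t [te t0]] : exists t : K, `|t| = e / 2 /\
    h3diag (shear z i (t *: u)) i != 0.
  by exists (shear z i (t *: u)); split; [split=> //; exact: sharp_shear|exact: be].
pose a := odot u (h3oct z (i + 2)) *+ 2.
pose b := odot u u * h3diag z (i + 1).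
have sE (t : K) : h3diag (shear z i (t *: u)) i = t * a + t ^+ 2 * b.
  rewrite h3_diag eqxx d0 add0r !(comp_dotZl oct_composition).
  rewrite (comp_dotC oct_composition u (t *: u)) (comp_dotZl oct_composition) /a /b.
  by rewrite mulrnAr expr2 !mulrA.
(* The candidates are [t = e / 2] and [t = - (e / 2)]. If both values vanish, their difference gives
   [a = 0], and then [b = 0]. *)
have [te|te] := eqVneq (h3diag (shear z i ((e / 2) *: u)) i) 0; last first.
  by exists (e / 2); rewrite gtr0_norm.
have [tN|tN] := eqVneq (h3diag (shear z i (- (e / 2) *: u)) i) 0; last first.
  by exists (- (e / 2)); rewrite normrN gtr0_norm.
exfalso; rewrite !sE sqrrN in te tN.
have e20 : e / 2 != 0 by rewrite gt_eqF.
have a0 : a = 0.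
  have : e / 2 * a *+ 2 = 0.
    rewrite -[RHS]subr0 -{1}te -tN; ring.
  by move/eqP; rewrite mulrn_eq0 mulf_eq0 (negPf e20) /= => /eqP.
have b0 : b = 0.
  move/eqP: te; rewrite a0 mulr0 add0r mulf_eq0 sqrf_eq0 (negPf e20) /=.
  by move/eqP.
by case: u0; rewrite -/a -/b ?a0 ?b0 eqxx.
Qed.

(** Since alpha_{i+1} <> 0 permits a shear at [i], [N (i + 1)] lies in the closure of [N i]; it is
    enough to approach [z] from some [N i]. If the diagonal is zero, some a_k is nonzero and [z] is
    a limit of points of [N (k + 1)]. *)
Lemma closure_null z : sharp z = 0 -> z != 0 ->
  closure [set w : H3 K | sharp w = 0 /\ h3diag w 0 != 0] z.
Proof.
move=> sz z0; pose N i := [set w : H3 K | sharp w = 0 /\ h3diag w i != 0].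
rewrite -/(N 0).
have clN i : closure (N (i + 1)) `<=` closure (N i).
  rewrite [X in _ `<=` X](closure_id _).1; last exact: closed_closure.
  by apply: closure_subset => w [sw wi]; apply: closure_shear => //; left.
have cl1 : closure (N 1) `<=` closure (N 0) by have := clN 0; rewrite add0r.
have cl2 : closure (N 2) `<=` closure (N 0).
  apply: subset_trans cl1; have := clN 1.
  by rewrite (_ : 1 + 1 = 2) //; exact: val_inj.
have e12 : 1 + 2 = 0 :> 'I_3 by apply: val_inj.
have e22 : 2 + 2 = 1 :> 'I_3 by apply: val_inj.
have [d0|] := eqVneq (h3diag z 0) 0; last by move=> ?; exact: subset_closure.
have [d1|?] := eqVneq (h3diag z 1) 0; last by apply: cl1; exact: subset_closure.
have [d2|?] := eqVneq (h3diag z 2) 0; last by apply: cl2; exact: subset_closure.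
have [q2|?] := eqVneq (h3oct z 2) 0; last first.
  by apply: closure_shear => //; right; rewrite add0r.
have [q0|?] := eqVneq (h3oct z 0) 0; last first.
  by apply: cl1; apply: closure_shear => //; right; rewrite e12.
have [q1|?] := eqVneq (h3oct z 1) 0; last first.
  by apply: cl2; apply: closure_shear => //; right; rewrite e22.
suff z00 : z = 0 by rewrite z00 eqxx in z0.
by apply: h3P => i; rewrite (h3diag0, h3oct0); elim/ord3_ind: i.
Qed.

Lemma dense_jmap : dense_in (calP K) (@jmap K @` calW K).
Proof.
rewrite image_jmap; split; first exact: subIsetl.
move=> L [z [z0 sz ->]] B /(continuous_pclass z0) nB.
have [w [[sw w0] Bw]] := closure_null sz z0 nB.
have wn : w != 0 by apply: contra_neq w0 => ->; rewrite h3diag0.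
exists (pclass w); split => //; split; first by exists w.
by rewrite proj_dom_class // -h3diag_ord0.
Qed.

(** * Holomorphy of j and of its inverse *)

Lemma biholomorphism_jmap :
  biholomorphism (affine_space K 27) (projective_space K 26)
    (calW K) (@jmap K @` calW K) (@jmap K).
Proof.
split.
- split; [by move=> x Wx; exists x | | by []].
  (* Injectivity: chart 0 normalizes alpha_1 to 1, so the class determines the vector [emb x], whose
     W part is [x]. *)
  move=> x y; rewrite !inE => Wx Wy; rewrite !jmapE // => exy.
  have : proj_chart 0 (pclass (emb x)) = proj_chart 0 (pclass (emb y)).
    by rewrite exy.
  rewrite !proj_chart_class ?emb_neq0 // !emb_ord0 invr1 !scale1r => /(congr1 (proj_hom 0)).
  rewrite !proj_hom_col ?emb_ord0 // => /(congr1 (@projW K)).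
  by rewrite !projW_emb !projW_id.
(* One extension serves at every point: the class of [emb], holomorphic on all of V. *)
- move=> x Wx; exists setT, (fun y => pclass (emb y)); split=> //.
    split; first exact: openT.
    move=> y _; split.
      apply: continuous_comp; last exact/continuous_pclass/emb_neq0.
      exact: differentiable_continuous (differentiable_emb _).
    move=> i j _ yj.
    rewrite (_ : _ \o _ =
      (fun z : 'rV[K]_27 => col' j ((z 0 j)^-1 *: z)) \o @emb K); last first.
      by apply/funext => t /=; rewrite proj_chart_class ?emb_neq0.
    apply: differentiable_comp; first exact: differentiable_emb.
    apply: differentiable_chart_class.
    by rewrite -proj_dom_class ?emb_neq0.
  by move=> y Wy _; rewrite jmapE.
(* In chart 0 the inverse reads off a_2 and a_3, where [proj_hom 0] restores alpha_1 = 1. It is its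
   own holomorphic extension to the whole chart domain. *)
- pose g (L : projective_space K 26) : affine_space K 27 :=
    projW (proj_hom 0 (proj_chart 0 L)).
  exists g; split=> [L|x Wx]; last first.
    rewrite jmapE // /g proj_chart_class ?emb_neq0 // emb_ord0 invr1 scale1r.
    by rewrite proj_hom_col ?emb_ord0 // projW_emb projW_id.
  rewrite image_jmap => -[_ L0]; exists (proj_dom 0), g.
  split; [exact: L0 | | by []].
  split; first exact: proj_dom_open.
  move=> {L L0} L L0; split.
    apply: (@continuous_comp _ _ _ (proj_chart 0) (@projW K \o proj_hom 0)).
      exact: proj_chart_cont.
    apply: differentiable_continuous.
    apply: differentiable_comp; first exact: differentiable_proj_hom.
    exact: differentiable_projW.
  move=> i j Li _.
  (* In chart [i], [g] is the transition to chart 0 followed by an affine map. *)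
  apply: (@differentiable_comp _ _ _ _ (proj_chart 0 \o proj_param i)
    (@projW K \o proj_hom 0)).
    exact: proj_transition.
  apply: differentiable_comp; first exact: differentiable_proj_hom.
  exact: differentiable_projW.
Qed.

End Analytic.

Theorem proposition3p10 (R : realType) :
  open_in (calP R[i]) (image (calW R[i]) (@jmap R[i])) /\
  dense_in (calP R[i]) (image (calW R[i]) (@jmap R[i])) /\
  biholomorphism (affine_space R[i] 27) (projective_space R[i] 26)
    (calW R[i]) (image (calW R[i]) (@jmap R[i])) (@jmap R[i]).
Proof.
split; last by split; [exact: dense_jmap | exact: biholomorphism_jmap].
exists (proj_dom 0); first exact: proj_dom_open.
exact: image_jmap.
Qed.
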